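(* Let $\theta$ be a real number, let $G_1$ and $G_2$ be two vertex-disjoint $\theta$-super positive graphs, and let $v_i\in V(G_i)$ for $i=1,2$. Let $G$ be the graph obtained by adding the edge $(v_1,v_2)$ to $G_1\cup G_2$. Then $G$ is $\theta$-super positive.
   Context: All graphs are finite and simple. For a graph $G$ on $n$ vertices, $p(G,r)$ is the number of $r$-matchings in $G$ ($p(G,0)=1$) and $\mu(G,x)=\sum_{r=0}^{\lfloor n/2\rfloor}(-1)^r p(G,r)x^{n-2r}$ is its matching polynomial. $G\setminus v$ denotes deletion of vertex $v$ (and incident edges). $G$ is $\theta$-super positive if $\mu(G,\theta)\neq 0$ and $\mu(G\setminus v,\theta)=0$ for every $v\in V(G)$. *)

(* Defs.v *)
From HB Require Import structures.
From mathcomp Require Import all_boot all_order all_algebra.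
From mathcomp Require Import reals.

Set Implicit Arguments.
Unset Strict Implicit.
Unset Printing Implicit Defensive.

Import GRing.Theory.
Local Open Scope ring_scope.

Record sgraph := SGraph {
  vertex :> finType;
  adj : rel vertex;
  adj_sym : symmetric adj;
  adj_irr : irreflexive adj }.

Definition edges (G : sgraph) : {set {set G}} :=
  [set [set u.1; u.2] | u : G * G & adj u.1 u.2].

(* The members of [edges G] being nonempty, [trivIset M] says that distinct
   edges of [M] share no endpoint. *)
Definition matching (G : sgraph) (M : {set {set G}}) : bool :=
  (M \subset edges G) && trivIset M.

Definition nb_matchings (G : sgraph) (r : nat) : nat :=
  #|[set M : {set {set G}} | matching M & #|M| == r]|.

(* The truncated subtraction is exact on the range of summation. *)
Definition matching_poly (R : nzRingType) (G : sgraph) : {poly R} :=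
  \sum_(0 <= r < #|G|./2.+1)
    ((-1) ^+ r * (nb_matchings G r)%:R) *: 'X^(#|G| - r.*2).

Section DeleteVertex.
Variables (G : sgraph) (v : G).

Definition del_adj : rel {x : G | x != v} := fun x y => adj (val x) (val y).

Lemma del_adj_sym : symmetric del_adj.
Proof. by move=> x y; apply: adj_sym. Qed.

Lemma del_adj_irr : irreflexive del_adj.
Proof. by move=> x; apply: adj_irr. Qed.

Definition del_vertex : sgraph := SGraph del_adj_sym del_adj_irr.
End DeleteVertex.

Section JoinByEdge.
Variables (G1 G2 : sgraph) (v1 : G1) (v2 : G2).

(* The disjoint union of G1 and G2 lives on the sum type G1 + G2. *)
Definition join_adj : rel (G1 + G2)%type := fun x y =>
  match x, y with
  | inl a, inl b => adj a b
  | inr a, inr b => adj a b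
  | inl a, inr b => (a == v1) && (b == v2)
  | inr b, inl a => (a == v1) && (b == v2)
  end.

Lemma join_adj_sym : symmetric join_adj.
Proof. by move=> [a|a] [b|b] //=; apply: adj_sym. Qed.

Lemma join_adj_irr : irreflexive join_adj.
Proof. by move=> [a|a] /=; apply: adj_irr. Qed.

Definition join_by_edge : sgraph := SGraph join_adj_sym join_adj_irr.
End JoinByEdge.

Definition super_positive (R : realType) (theta : R) (G : sgraph) : Prop :=
  (matching_poly R G).[theta] != 0 /\
  forall v : G, (matching_poly R (del_vertex v)).[theta] = 0.

(* Main.v *)
Require Import Defs.
From mathcomp Require Import all_boot all_order all_algebra.
From mathcomp Require Import reals.

Set Implicit Arguments.
Unset Strict Implicit.
Unset Printing Implicit Defensive.

Import GRing.Theory.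
Local Open Scope ring_scope.

(** Deleting the bridge [v1 v2] of [G] gives
    [mu(G) = mu(G1) mu(G2) - mu(G1 \ v1) mu(G2 \ v2)], and the same identity
    holds for every induced subgraph of [G], the last product being absent
    when [v1] or [v2] has been deleted. At [theta] both factors of the last
    product of [mu(G)] vanish, whereas its first product does not; in
    [mu(G \ v)] with [v] in [G1] the factors [mu(G1 \ v)] and [mu(G2 \ v2)]
    vanish, and symmetrically for [v] in [G2]. *)

(** * Matchings made of the edges that lie inside a vertex set *)

Section MatchingsIn.
Variable T : finType.
Implicit Types (E M : {set {set T}}) (A e : {set T}).

(** Edges and vertices vary independently over one fixed type: deleting an edge shrinks [E],
    deleting vertices shrinks [A], and the vertex type never changes. *)
Definition matchings_in E A : {set {set {set T}}} :=
  [set M : {set {set T}} | (M \subset E ::&: A) && trivIset M].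

Lemma matchings_in_sub E A M e :
  M \in matchings_in E A -> e \in M -> e \in E /\ e \subset A.
Proof.
by rewrite inE => /andP[/subsetP sM _] /sM; rewrite !inE => /andP[].
Qed.

Lemma matchings_in_eqr E E' A :
  E ::&: A = E' ::&: A -> matchings_in E A = matchings_in E' A.
Proof. by rewrite /matchings_in => ->. Qed.

Lemma matchings_in_card E A M :
    {in E, forall e, #|e| = 2%N} -> M \in matchings_in E A ->
  (#|M|.*2 <= #|A|)%N.
Proof.
move=> E2 MA; have sM e (eM : e \in M) := matchings_in_sub MA eM.
have : (#|cover M| <= #|A|)%N.
  by apply/subset_leq_card/bigcupsP => e /sM[].
move: MA; rewrite inE => /andP[_ /eqP <-].
by rewrite (eq_bigr (fun=> 2%N)) ?sum_nat_const ?muln2 // => e /sM[/E2].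
Qed.

Lemma matchings_in_nomem E A e :
  [set M in matchings_in E A | e \notin M] = matchings_in (E :\ e) A.
Proof.
apply/setP=> M; rewrite !inE andbAC; congr (_ && _).
have -> : (E :\ e) ::&: A = (E ::&: A) :\ e.
  by apply/setP=> d; rewrite !inE andbA.
by rewrite subsetD1.
Qed.

(** With [matchings_in_rem], this makes adding [e] a bijection from the matchings in [A :\: e] onto
    the matchings in [A] that contain [e]. A nonempty [e] is not inside [A :\: e], hence is not in
    [M]. *)
Lemma matchings_in_addU E A e M :
    e \in E -> e \subset A -> e != set0 -> M \in matchings_in E (A :\: e) ->
  (e \notin M) /\ (e |: M \in matchings_in E A).
Proof.
move=> eE eA e0 MA; have sM d (dM : d \in M) := matchings_in_sub MA dM.
have eM : e \notin M.
  apply/negP=> /sM[_]; rewrite subsetD => /andP[_].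
  by rewrite -setI_eq0 setIid (negPf e0).
split=> //; rewrite inE; apply/andP; split.
  apply/subsetP=> d /setU1P[->|/sM[dE]]; rewrite !inE ?eE //.
  by rewrite subsetD dE => /andP[].
apply/trivIsetP=> c d /setU1P[->|cM] /setU1P[->|dM]; rewrite ?eqxx // => ncd.
- by have [_] := sM _ dM; rewrite subsetD disjoint_sym => /andP[].
- by have [_] := sM _ cM; rewrite subsetD => /andP[].
- by move: MA; rewrite inE => /andP[_ /trivIsetP]; apply.
Qed.

Lemma matchings_in_rem E A e M :
  M \in matchings_in E A -> e \in M -> M :\ e \in matchings_in E (A :\: e).
Proof.
move=> MA eM; have sM d (dM : d \in M) := matchings_in_sub MA dM.
move: MA; rewrite !inE => /andP[_ tM].
rewrite (trivIsetS (subD1set _ _) tM) andbT.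
apply/subsetP=> d /setD1P[nde dM]; have [dE dA] := sM _ dM.
by rewrite !inE dE subsetD dA /= (trivIsetP tM).
Qed.

Lemma matchings_in_U E A1 A2 M1 M2 : [disjoint A1 & A2] ->
    M1 \in matchings_in E A1 -> M2 \in matchings_in E A2 ->
  M1 :|: M2 \in matchings_in E (A1 :|: A2).
Proof.
move=> dA M1A M2A.
have s1 d (dM : d \in M1) := matchings_in_sub M1A dM.
have s2 d (dM : d \in M2) := matchings_in_sub M2A dM.
move: M1A M2A; rewrite !inE => /andP[_ /trivIsetP t1] /andP[_ /trivIsetP t2].
have dM c d : c \in M1 -> d \in M2 -> [disjoint c & d].
  move=> /s1[_ cA] /s2[_ dA2].
  exact: disjointWl cA (disjointWr dA2 dA).
apply/andP; split.
  apply/subsetP=> d /setUP[/s1|/s2] [dE dA']; rewrite !inE dE /=.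
    exact: subset_trans dA' (subsetUl _ _).
  exact: subset_trans dA' (subsetUr _ _).
apply/trivIsetP=> c d /setUP[c1|c2] /setUP[d1|d2] ncd.
- exact: t1.
- exact: dM.
- by rewrite disjoint_sym; apply: dM.
- exact: t2.
Qed.

Lemma matchings_in_restr E A B M :
  M \in matchings_in E A -> M ::&: B \in matchings_in E B.
Proof.
move=> MA; have sM d (dM : d \in M) := matchings_in_sub MA dM.
move: MA; rewrite !inE => /andP[_ tM].
rewrite (trivIsetS _ tM) ?andbT; last first.
  by apply/subsetP=> d; rewrite inE => /andP[].
by apply/subsetP=> d; rewrite !inE => /andP[/sM[-> _] ->].
Qed.

End MatchingsIn.

(** * Matching polynomials of induced subgraphs *)

Section SubsetMatchingPoly.
Variables (R : comNzRingType) (T : finType).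
Implicit Types (E M : {set {set T}}) (A e : {set T}).

(** Summing over matchings rather than over their sizes lets bijections between matchings act
    directly as reindexings. *)
Definition submatching_poly E A : {poly R} :=
  \sum_(M in matchings_in E A) (-1) ^+ #|M| * 'X^(#|A| - #|M|.*2).

(** Matchings avoiding [e] give the first term. Removing [e] from the others flips the sign and
    keeps the exponent, since one edge and two vertices disappear. *)
Lemma submatching_poly_edge E A e : e \in E -> e \subset A -> #|e| = 2%N ->
  submatching_poly E A =
    submatching_poly (E :\ e) A - submatching_poly E (A :\: e).
Proof.
move=> eE eA e2; have e0 : e != set0 by rewrite -card_gt0 e2.
rewrite /submatching_poly (bigID (fun M => e \in M)) /= addrC; congr (_ + _).
  by rewrite -matchings_in_nomem; apply: eq_bigl => M; rewrite [RHS]inE.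
rewrite -sumrN (reindex_onto (fun M => e |: M) (fun M => M :\ e)) /=; last first.
  by move=> M /andP[_ eM]; rewrite setD1K.
apply: eq_big => [M|M].
  apply/idP/idP => [/andP[/andP[MA eM] /eqP <-]|MA].
    exact: matchings_in_rem.
  have [eM ->] := matchings_in_addU eE eA e0 MA.
  by rewrite setU11 setU1K // eqxx.
move=> /andP[_ /eqP defM].
have eM : e \notin M by rewrite -defM !inE eqxx.
rewrite cardsU1 eM add1n exprS mulN1r mulNr cardsD (setIidPr eA) e2.
by rewrite doubleS -[_.*2.+2]add2n subnDA.
Qed.

(** No edge crosses between the two parts, so a matching is determined by its traces on [A1] and
    [A2], which can be chosen independently. *)
Lemma submatching_polyU E A1 A2 :
    {in E, forall e, #|e| = 2%N} -> [disjoint A1 & A2] ->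
    {in E, forall e : {set T}, e \subset A1 :|: A2 ->
       (e \subset A1) || (e \subset A2)} ->
  submatching_poly E (A1 :|: A2) =
    submatching_poly E A1 * submatching_poly E A2.
Proof.
move=> E2 dA sE; rewrite /submatching_poly big_distrlr /= pair_big /=.
have not12 e : e \in E -> e \subset A1 -> e \subset A2 -> False.
  move=> /E2 e2 e1 eA2; suff : e == set0 by rewrite -cards_eq0 e2.
  by rewrite -subset0 -(disjoint_setI0 dA) subsetI e1.
have restrU M1 M2 : M1 \in matchings_in E A1 -> M2 \in matchings_in E A2 ->
    ((M1 :|: M2) ::&: A1 = M1) * ((M1 :|: M2) ::&: A2 = M2).
  move=> M1A M2A.
  split; apply/setP=> d; rewrite !inE; apply/andP/idP.
  - case=> /orP[//|/(matchings_in_sub M2A)[dE d2] d1].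
    by case: (not12 d).
  - by move=> dM; rewrite dM; have [] := matchings_in_sub M1A dM.
  - case=> /orP[/(matchings_in_sub M1A)[dE d1] d2|//].
    by case: (not12 d).
  - by move=> dM; rewrite dM orbT; have [] := matchings_in_sub M2A dM.
rewrite (reindex_onto (fun p : _ * _ => p.1 :|: p.2)
                      (fun M => (M ::&: A1, M ::&: A2))) /=; last first.
  move=> M MA; apply/setP=> d; rewrite !inE -andb_orr.
  by apply: andb_idr => /(matchings_in_sub MA)[dE]; apply: sE.
have restrM M1 M2 : ((M1 :|: M2 \in matchings_in E (A1 :|: A2)) &&
      (((M1 :|: M2) ::&: A1, (M1 :|: M2) ::&: A2) == (M1, M2))) =
    (M1 \in matchings_in E A1) && (M2 \in matchings_in E A2).
  apply/andP/andP => [[MA /eqP[def1 def2]]|[M1A M2A]].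
    by split; [rewrite -def1|rewrite -def2]; apply: matchings_in_restr MA.
  by rewrite matchings_in_U // !restrU //= eqxx.
apply: eq_big => [[M1 M2]|[M1 M2]] /=; first exact: restrM.
rewrite restrM => /andP[M1A M2A].
have M12 : M1 :&: M2 = set0.
  apply/setP=> d; rewrite !inE; apply/andP=> -[d1 d2].
  have [dE dA1] := matchings_in_sub M1A d1.
  have [_ dA2] := matchings_in_sub M2A d2.
  exact: (not12 d).
rewrite !cardsU (disjoint_setI0 dA) M12 !cards0 !subn0 exprD mulrACA -!exprD.
(* These bounds make the truncated subtractions exact, so the exponents add up. *)
have := matchings_in_card E2 M1A; have := matchings_in_card E2 M2A.
by move=> le2 le1; rewrite doubleD subnDA -addnBAC // -addnBA.
Qed.

End SubsetMatchingPoly.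

(** * Edges and matching polynomials of graphs *)

Lemma edges_card2 (G : sgraph) : {in edges G, forall e : {set G}, #|e| = 2%N}.
Proof.
move=> e /imsetP[[x y] /=]; rewrite inE /= => xy ->.
rewrite cards2; case: eqP xy => // ->.
by rewrite adj_irr.
Qed.

Lemma edgesP (G : sgraph) (e : {set G}) :
  reflect (exists x y, adj x y /\ e = [set x; y]) (e \in edges G).
Proof.
apply: (iffP imsetP) => [[[x y]]|[x [y [xy ->]]]].
  by rewrite inE /= => xy ->; exists x, y.
by exists (x, y); rewrite ?inE.
Qed.

Lemma matching_polyE (R : comNzRingType) (G : sgraph) :
  matching_poly R G = submatching_poly R (edges G) setT.
Proof.
have inT M : (M \in matchings_in (edges G) setT) = matching M.
  rewrite inE /matching; suff -> : edges G ::&: setT = edges G by [].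
  by apply/setP=> e; rewrite !inE subsetT andbT.
rewrite /submatching_poly /matching_poly big_mkord.
(* Matchings are grouped by size. A matching has at most [#|G|./2] edges, so [inord] never falls
   back on its default value. *)
rewrite (partition_big (fun M : {set {set G}} => inord #|M| : 'I_(#|G|./2.+1))
  predT) //=.
apply: eq_bigr => r _; set k := (#|G| - r.*2)%N.
have sizeM M : (M \in matchings_in (edges G) setT) && (inord #|M| == r) =
    (M \in [set M : {set {set G}} | matching M & #|M| == r]).
  rewrite [RHS]inE -inT; case MT: (M \in _) => //=.
  rewrite -val_eqE /= inordK // ltnS -[#|M|]doubleK half_leq //.
  by have := matchings_in_card (@edges_card2 G) MT; rewrite cardsT.
rewrite (eq_bigl _ _ sizeM).
rewrite (eq_bigr (fun=> (-1) ^+ r * 'X^k)); last first.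
  by move=> M; rewrite inE cardsT => /andP[_ /eqP->].
rewrite sumr_const -/(nb_matchings G r) mulr_natr -scalerMnl.
by rewrite -mul_polyC rmorphXn /= rmorphN1.
Qed.

(** * Invariance under embeddings as induced subgraphs *)

Section Embedding.
Variables (R : comNzRingType) (H G : sgraph) (f : H -> G).
Hypothesis f_inj : injective f.
Hypothesis f_adj : forall x y, adj (f x) (f y) = adj x y.

Lemma edges_imset (e : {set H}) : (f @: e \in edges G) = (e \in edges H).
Proof.
apply/edgesP/edgesP => [[x' [y' [xy fe]]]|[x [y [xy ->]]]]; last first.
  by exists (f x), (f y); rewrite f_adj imsetU !imset_set1.
have /imsetP[x _ xE] : x' \in f @: e by rewrite fe !inE eqxx.
have /imsetP[y _ yE] : y' \in f @: e by rewrite fe !inE eqxx orbT.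
exists x, y; split; first by rewrite -f_adj -xE -yE.
by apply: (imset_inj f_inj); rewrite fe imsetU !imset_set1 xE yE.
Qed.

(** Taking images of edges under [f] is a size-preserving bijection from the matchings inside [A]
    onto those inside [f @: A]. *)
Lemma submatching_poly_imset (A : {set H}) :
  submatching_poly R (edges G) (f @: A) = submatching_poly R (edges H) A.
Proof.
have F_inj := imset_inj f_inj; have FF_inj := imset_inj F_inj.
have fA (e : {set H}) : (f @: e \subset f @: A) = (e \subset A).
  apply/idP/idP => [/subsetP s|]; last exact: imsetS.
  by apply/subsetP=> x xe; have := s (f x); rewrite !mem_imset //; apply.
have -> : submatching_poly R (edges G) (f @: A) =
    \sum_(M in (fun N : {set {set H}} => [set f @: (e : {set H}) | e in N])
                 @: matchings_in (edges H) A)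
      (-1) ^+ #|M| * 'X^(#|f @: A| - #|M|.*2).
  apply: eq_bigl => M; apply/idP/imsetP => [MA|[N NA ->]].
    have sM e' : e' \in M -> exists e : {set H},
        [/\ e' = f @: e, e \in edges H & e \subset A].
      move=> /(matchings_in_sub MA)[e'E e'A].
      (* An edge inside [f @: A] lies in the range of [f], so it is the image of its preimage. *)
      have e'f : e' = f @: (f @^-1: e').
        apply/setP=> y; apply/idP/imsetP => [ye|[x]]; last first.
          by rewrite inE => ? ->.
        have /imsetP[x _ yx] := subsetP e'A y ye.
        by exists x => //; rewrite inE -yx.
      by exists (f @^-1: e'); rewrite -edges_imset -fA -e'f.
    have defM :
        M = [set f @: (e : {set H}) | e in [set e : {set H} | f @: e \in M]].
      apply/setP=> e'; apply/idP/imsetP => [e'M|[e]]; last first.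
        by rewrite inE => ? ->.
      by have [e [defe _ _]] := sM _ e'M; exists e; rewrite // inE -defe.
    exists [set e : {set H} | f @: e \in M] => //.
    move: MA; rewrite !inE => /andP[_]; rewrite {1}defM imset_trivIset // => ->.
    rewrite andbT; apply/subsetP=> e; rewrite !inE => /sM.
    by case=> d [/F_inj <- -> ->].
  have sN e (eN : e \in N) := matchings_in_sub NA eN.
  move: NA; rewrite !inE imset_trivIset // => /andP[_ ->]; rewrite andbT.
  apply/subsetP=> _ /imsetP[e /sN[eE eA] ->].
  by rewrite !inE edges_imset eE fA.
rewrite big_imset /=; last by move=> M N _ _; apply: FF_inj.
by apply: eq_bigr => M _; rewrite !card_imset.
Qed.

End Embedding.

(** The projection [val] embeds the deleted graph, which lives on a subtype, onto the complement of
    [v] in [G]. *)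
Lemma matching_poly_del (R : comNzRingType) (G : sgraph) (v : G) :
  matching_poly R (del_vertex v) = submatching_poly R (edges G) (setT :\ v).
Proof.
pose f (x : del_vertex v) : G := val x.
rewrite matching_polyE -(submatching_poly_imset R (f := f)) //; last first.
  exact: val_inj.
congr submatching_poly; apply/setP=> x; rewrite !inE andbT.
apply/imsetP/idP => [[y _ ->]|xv]; first exact: (valP y).
by exists (Sub x xv : del_vertex v); rewrite ?SubK.
Qed.

(** * Two graphs joined by a bridge *)

Lemma in_setU_inl_inr (T1 T2 : finType) (B1 : {set T1}) (B2 : {set T2})
    (z : T1 + T2) :
  (z \in inl @: B1 :|: inr @: B2) =
  match z with inl x => x \in B1 | inr x => x \in B2 end.
Proof.
rewrite inE; case: z => x.
  rewrite mem_imset; last by move=> ? ? [].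
  by rewrite orbC; case: imsetP => // -[].
rewrite [X in _ || X]mem_imset; last by move=> ? ? [].
by case: imsetP => // -[].
Qed.

(** Edge recursion at the bridge, followed by factorization over the two sides. The boolean
    multiplicity keeps the correction term exactly when both ends of the bridge survive. *)
Lemma submatching_poly_join (R : comNzRingType) (G1 G2 : sgraph)
    (v1 : G1) (v2 : G2) (A1 : {set G1}) (A2 : {set G2}) :
  submatching_poly R (edges (join_by_edge v1 v2)) (inl @: A1 :|: inr @: A2) =
    submatching_poly R (edges G1) A1 * submatching_poly R (edges G2) A2
    - (submatching_poly R (edges G1) (A1 :\ v1)
       * submatching_poly R (edges G2) (A2 :\ v2))
      *+ ((v1 \in A1) && (v2 \in A2)).
Proof.
set G := join_by_edge v1 v2; set E := edges G.
set e : {set G} := [set inl v1; inr v2].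
have inl_inj : injective (inl : G1 -> G) by move=> x y [].
have inr_inj : injective (inr : G2 -> G) by move=> x y [].
have polyl (B : {set G1}) :
    submatching_poly R E (inl @: B) = submatching_poly R (edges G1) B.
  exact: submatching_poly_imset.
have polyr (B : {set G2}) :
    submatching_poly R E (inr @: B) = submatching_poly R (edges G2) B.
  exact: submatching_poly_imset.
have eE : e \in E by apply/edgesP; exists (inl v1), (inr v2); rewrite /= !eqxx.
have inlr (x : G2) (B : {set G1}) : (inr x : G) \in inl @: B = false.
  by apply/imsetP => -[].
have inrl (x : G1) (B : {set G2}) : (inl x : G) \in inr @: B = false.
  by apply/imsetP => -[].
have disj (B1 : {set G1}) (B2 : {set G2}) :
    [disjoint (inl @: B1 : {set G}) & (inr @: B2 : {set G})].
  rewrite disjoint_subset; apply/subsetP=> _ /imsetP[x _ ->].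
  by rewrite inE inrl.
(* The set [F] is kept general because the bridge can be absent in two ways: removed from the edges,
   or missing an end in the vertex set. *)
have splitE (F : {set {set G}}) (B1 : {set G1}) (B2 : {set G2}) : F \subset E ->
    ~~ ((e \in F) && (e \subset inl @: B1 :|: inr @: B2)) ->
    submatching_poly R F (inl @: B1 :|: inr @: B2) =
    submatching_poly R F (inl @: B1) * submatching_poly R F (inr @: B2).
  move=> /subsetP FE eNF.
  apply: submatching_polyU => // [d /FE|d dF dB]; first exact: edges_card2.
  have d_e : d <> e by move=> de; move: eNF; rewrite -de dF dB.
  (* In the two mixed cases adjacency forces [d] to be the bridge. *)
  have /edgesP[[x|x] [[y|y] [xy dE]]] := FE d dF; move: dB.
  - by rewrite dE !subUset !sub1set !in_setU_inl_inr !mem_imset // => ->.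
  - by case: d_e; move: xy => /= /andP[/eqP xE /eqP yE]; rewrite dE xE yE.
  - by case: d_e; move: xy => /= /andP[/eqP xE /eqP yE]; rewrite dE xE yE setUC.
  - rewrite dE !subUset !sub1set !in_setU_inl_inr !mem_imset // => ->.
    by rewrite orbT.
have eA : (e \subset inl @: A1 :|: inr @: A2) = (v1 \in A1) && (v2 \in A2).
  by rewrite subUset !sub1set !in_setU_inl_inr.
case: (_ && _) eA => eA; last first.
  by rewrite splitE ?eA ?andbF // polyl polyr subr0.
rewrite (submatching_poly_edge R eE) ?eA ?(edges_card2 eE) //.
have -> : (inl @: A1 :|: inr @: A2) :\: e =
    inl @: (A1 :\ v1) :|: inr @: (A2 :\ v2) :> {set G}.
  by apply/setP=> -[x|x]; rewrite !inE !(inlr, inrl) !mem_imset ?inE ?orbF.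
(* A single side never contains the bridge, so its polynomial does not see the removal of [e]. *)
have rmE (B : {set G}) : ~~ (e \subset B) ->
    submatching_poly R (E :\ e) B = submatching_poly R E B.
  move=> eB; rewrite /submatching_poly (@matchings_in_eqr _ _ E) //.
  apply/setP=> d; rewrite !inE; case: eqP => //= ->.
  by rewrite (negPf eB) andbF.
rewrite splitE ?subD1set //; last by rewrite !inE eqxx.
rewrite !rmE ?subUset ?sub1set ?inlr ?inrl ?andbF //.
(* Here [e] is still in [E], but its ends have been deleted from the vertex set. *)
rewrite splitE //; last first.
  by rewrite subUset !sub1set in_setU_inl_inr !inE eqxx andbF.
by rewrite !polyl !polyr.
Qed.

(** * Evaluation at [theta] *)

Theorem theorem2p2 (R : realType) (theta : R) (G1 G2 : sgraph)
    (hG1 : super_positive theta G1) (hG2 : super_positive theta G2)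
    (v1 : G1) (v2 : G2) :
  super_positive theta (join_by_edge v1 v2).
Proof.
case: hG1 => G1n0 G1v; case: hG2 => G2n0 G2v.
set G := join_by_edge v1 v2.
have val1 v : (submatching_poly R (edges G1) (setT :\ v)).[theta] = 0.
  by rewrite -matching_poly_del.
have val2 v : (submatching_poly R (edges G2) (setT :\ v)).[theta] = 0.
  by rewrite -matching_poly_del.
split=> [|[v|v]].
- have := submatching_poly_join R v1 v2 setT setT.
  have -> : inl @: setT :|: inr @: setT = setT :> {set G}.
    by apply/setP=> -[x|x]; rewrite in_setU_inl_inr !inE.
  rewrite matching_polyE !inE => ->.
  rewrite hornerD hornerN !hornerM val1 mul0r subr0.
  by rewrite -!matching_polyE mulf_neq0.
- have := submatching_poly_join R v1 v2 (setT :\ v) setT.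
  have -> : inl @: (setT :\ v) :|: inr @: setT = setT :\ (inl v : G).
    by apply/setP=> -[x|x]; rewrite in_setU_inl_inr !inE.
  rewrite matching_poly_del => ->.
  rewrite hornerD hornerN hornerMn !hornerM.
  (* The correction is zero whatever its multiplicity, so [v = v1] and [v != v1] need no separate
     treatment. *)
  by rewrite val1 val2 mulr0 mul0r mul0rn subr0.
- have := submatching_poly_join R v1 v2 setT (setT :\ v).
  have -> : inl @: setT :|: inr @: (setT :\ v) = setT :\ (inr v : G).
    by apply/setP=> -[x|x]; rewrite in_setU_inl_inr !inE.
  rewrite matching_poly_del => ->.
  rewrite hornerD hornerN hornerMn !hornerM.
  by rewrite val1 val2 mulr0 mul0r mul0rn subr0.
Qed.
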